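(* Let $n,k$ be integers with $1\le k\le n-1$ and let $G\in\mathbb{V}_n^k$, i.e. $G$ is a connected simple graph with $n$ vertices and vertex connectivity $\kappa(G)\le k$. Then $$\prod\nolimits_1(G)\ge (n-1)^2\quad\text{and}\quad \prod\nolimits_2(G)\ge 4^{n-2},$$ where equality holds in the first inequality if and only if $G\cong S_n$, and in the second if and only if $G\cong P_n$.
   Context: All graphs are finite, simple and connected. $d(u)$ is the degree of a vertex $u$. The first and second multiplicative Zagreb indices are $\prod_1(G)=\prod_{u\in V(G)}d(u)^2$ and $\prod_2(G)=\prod_{uv\in E(G)}d(u)d(v)=\prod_{u\in V(G)}d(u)^{d(u)}$. A graph is $k$-connected ($k\ge1$) if it is either the complete graph $K_{k+1}$, or has at least $k+2$ vertices and has no vertex cut of size $k-1$; $\kappa(G)$ is the largest $k$ for which $G$ is $k$-connected. $\mathbb{V}_n^k$ is the set of connected graphs with $n$ vertices and $\kappa(G)\le k\le n-1$. $P_n$ and $S_n$ denote the path and the star on $n$ vertices. *)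

(* Defs.v *)
From mathcomp Require Import all_boot.

Set Implicit Arguments.
Unset Strict Implicit.
Unset Printing Implicit Defensive.

Record sgraph := SGraph {
  svertex :> finType;
  sedge : rel svertex;
  sedge_sym : symmetric sedge;
  sedge_irrefl : irreflexive sedge }.

Definition giso (G H : sgraph) : Prop :=
  exists f : G -> H,
    bijective f /\ forall x y : G, sedge (f x) (f y) = sedge x y.

Definition connected (G : sgraph) : bool :=
  [forall x : G, forall y : G, connect (@sedge G) x y].

Definition complete (G : sgraph) : bool :=
  [forall x : G, forall y : G, (x != y) ==> sedge x y].

Section Induced.
Variables (G : sgraph) (A : {set G}).

Definition induced_rel : rel {x : G | x \in A} :=
  fun x y => sedge (val x) (val y).

Lemma induced_sym : symmetric induced_rel.
Proof. by move=> x y; apply: sedge_sym. Qed.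

Lemma induced_irrefl : irreflexive induced_rel.
Proof. by move=> x; apply: sedge_irrefl. Qed.

Definition induced : sgraph := SGraph induced_sym induced_irrefl.
End Induced.

Definition vertex_cut (G : sgraph) (S : {set G}) : bool :=
  ~~ connected (induced (~: S)).

Definition kconnected (k : nat) (G : sgraph) : bool :=
  (1 <= k) &&
  ((complete G && (#|G| == k.+1)) ||
   ((k.+2 <= #|G|) &&
    [forall S : {set G}, (#|S| == k.-1) ==> ~~ vertex_cut S])).

(* A k-connected graph has more than k vertices, so this ranges over every
   relevant k; the value is 0 when G is k-connected for no k >= 1. *)
Definition kappa (G : sgraph) : nat := \max_(k < #|G| | kconnected k G) k.

Lemma kconnected_ltn k (G : sgraph) : kconnected k G -> k < #|G|.
Proof.
by case/andP=> _ /orP[/andP[_ /eqP->]//|/andP[h _]]; apply: leq_trans h.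
Qed.

Lemma leq_kappa k (G : sgraph) : kconnected k G -> k <= kappa G.
Proof.
move=> h; have hk := kconnected_ltn h.
exact: (@leq_bigmax_cond _ (fun i : 'I_#|G| => kconnected i G) (fun i => val i)
  (Ordinal hk)).
Qed.

Lemma kconnected_kappa k (G : sgraph) :
  kconnected k G -> kconnected (kappa G) G.
Proof.
move=> h; have hk := kconnected_ltn h.
rewrite /kappa (bigmax_eq_arg (Ordinal hk)) //.
by case: arg_maxnP.
Qed.

Definition Vnk (n k : nat) (G : sgraph) : bool :=
  [&& connected G, #|G| == n, kappa G <= k & k <= n - 1].

Definition deg (G : sgraph) (u : G) : nat := #|[set v : G | sedge u v]|.

Definition edges (G : sgraph) : {set {set G}} :=
  [set [set p.1; p.2] | p in [pred p : G * G | sedge p.1 p.2]].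

Definition zagreb1 (G : sgraph) : nat := \prod_(u : G) deg u ^ 2.

(* The inner product runs over the two ends of the edge e. *)
Definition zagreb2 (G : sgraph) : nat :=
  \prod_(e in edges G) \prod_(u in e) deg u.

Lemma zagreb2E (G : sgraph) : zagreb2 G = \prod_(u : G) deg u ^ deg u.
Proof.
rewrite /zagreb2 (exchange_big_dep predT) //=; apply: eq_bigr => u _.
rewrite prod_nat_const; congr (_ ^ _); rewrite /deg.
rewrite -(@card_in_imset _ _ (fun v => [set u; v])).
  apply: eq_card => e; apply/andP/imsetP.
  - case=> /imsetP[[x y] /= xy ->].
    case/set2P=> ->; first by exists y; rewrite ?inE.
    by exists x; rewrite ?inE 1?sedge_sym // setUC.
  - case=> v; rewrite inE => uv ->; split; last by rewrite !inE eqxx.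
    by apply/imsetP; exists (u, v); rewrite ?inE.
move=> v w; rewrite !inE => uv uw /setP/(_ v).
rewrite !inE eqxx orbT => /esym/orP[]/eqP // E.
by rewrite E sedge_irrefl in uv.
Qed.

Section PathStar.
Variable n : nat.

Definition path_rel : rel 'I_n := fun i j => (i.+1 == j) || (j.+1 == i).

Lemma path_sym : symmetric path_rel.
Proof. by move=> i j; rewrite /path_rel orbC. Qed.

Lemma path_irrefl : irreflexive path_rel.
Proof. by move=> i; rewrite /path_rel orbb eqn_leq ltnn. Qed.

Definition path_graph : sgraph := SGraph path_sym path_irrefl.

Definition star_rel : rel 'I_n :=
  fun i j => (i != j) && ((val i == 0) || (val j == 0)).

Lemma star_sym : symmetric star_rel.
Proof. by move=> i j; rewrite /star_rel eq_sym orbC. Qed.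

Lemma star_irrefl : irreflexive star_rel.
Proof. by move=> i; rewrite /star_rel eqxx. Qed.

Definition star_graph : sgraph := SGraph star_sym star_irrefl.
End PathStar.

(* Main.v *)
Require Import Defs.
From mathcomp Require Import all_boot.
From mathcomp Require Import zify.

(** A connected graph on [n] vertices satisfies [\sum_u (deg u - 1) >= n - 2],
    by the handshake lemma and a count of at least [n - 1] edges.  The first bound
    is then Bernoulli's inequality [\prod_u (1 + x u) >= 1 + \sum_u x u] with
    [x u = deg u - 1]; equality forces at most one nonzero [x u].  The second is
    [d ^ d >= 4 ^ (d - 1)], strict for [d >= 3]; equality leaves degrees at most
    [2] and some vertex of degree [1], from which the whole graph unrolls as a
    path. *)

(** * Edge count in a connected graph *)

Section Connected.
Variable G : sgraph.
Hypothesis Gconn : connected G.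

(** Otherwise [A] would be closed under adjacency, so it would contain everything reachable from
    [x], including [y]. *)
Lemma connected_boundary {A : {set G}} {x y : G} : x \in A -> y \notin A ->
  exists a b, [/\ a \in A, b \notin A & sedge a b].
Proof.
move=> xA yA.
have [/existsP[a /existsP[b /and3P[]]]|/existsPn h] :=
  boolP [exists a, exists b, [&& a \in A, b \notin A & sedge a b]].
  by exists a, b.
have cA : closed (@sedge G) (mem A).
  apply: intro_closed; first exact/sym_connect_sym/sedge_sym.
  move=> a b ab aA; have /existsPn/(_ b) := h a.
  by rewrite aA ab andbT negbK.
have /forallP/(_ y) xy := forallP Gconn x.
by move: (closed_connect cA xy) => /= xyA; move: yA; rewrite -xyA xA.
Qed.

Lemma deg_gt0 (x : G) : 1 < #|G| -> 0 < deg x.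
Proof.
rewrite -cardsT (cardsD1 x) inE add1n ltnS => /card_gt0P[y].
rewrite !inE andbT => yx.
have [||a [b [/set1P-> _ xb]]] := @connected_boundary [set x] x y.
- exact: set11.
- by rewrite inE.
by apply/card_gt0P; exists b; rewrite inE.
Qed.

(** Ordered pairs count each edge once from either end, as the handshake lemma does. *)
Definition arcs (A : {set G}) : {set G * G} :=
  [set p | [&& p.1 \in A, p.2 \in A & sedge p.1 p.2]].

Lemma sum_deg : \sum_(u : G) deg u = #|arcs setT|.
Proof.
rewrite -sum1_card.
under eq_bigr => u _ do rewrite /deg -sum1_card.
rewrite pair_big_dep /=; apply: eq_bigl => p.
by rewrite !inE.
Qed.

(** Grow [A] one vertex at a time along a boundary edge; each new vertex brings that edge in both
    orientations. *)
Lemma connected_subset_arcs (k : nat) : k < #|G| ->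
  exists A : {set G}, #|A| = k.+1 /\ k.*2 <= #|arcs A|.
Proof.
elim: k => [/card_gt0P[x _]|k IHk ltkG]; first by exists [set x]; rewrite cards1.
have [A [cA arcsA]] := IHk (ltnW ltkG).
have /card_gt0P[x xA] : 0 < #|A| by rewrite cA.
have [y yA] : exists y, y \notin A.
  have /card_gt0P[y] : 0 < #|~: A| by have := cardsC A; lia.
  by rewrite inE => yA; exists y.
have [a [b [aA bA ab]]] := connected_boundary xA yA.
exists (b |: A); split; first by rewrite cardsU1 bA cA.
have neq_ab : a != b by apply: contraNneq bA => <-.
have sub : (a, b) |: ((b, a) |: arcs A) \subset arcs (b |: A).
  apply/subsetP=> p; rewrite !inE => /or3P[/eqP->|/eqP->|/and3P[-> -> ->]] /=.
  - by rewrite eqxx aA ab !orbT.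
  - by rewrite eqxx aA sedge_sym ab !orbT.
  - by rewrite !orbT.
apply: leq_trans (subset_leq_card sub); rewrite !cardsU1 !inE /= !xpair_eqE.
by rewrite (negPf neq_ab) (negPf bA) !andbF /= doubleS !add1n !ltnS.
Qed.

Lemma connected_sum_deg : (#|G|.-1).*2 <= \sum_(u : G) deg u.
Proof.
have [G0|] := posnP #|G|; first by rewrite G0.
move=> G_gt0; have [|A [cA arcsA]] := connected_subset_arcs #|G|.-1; first by rewrite ltn_predL.
have AT : A = setT.
  by apply/eqP; rewrite eqEcard subsetT cardsT cA (prednK G_gt0) leqnn.
by rewrite sum_deg -AT.
Qed.

Lemma connected_sum_deg_pred : 1 < #|G| -> #|G| - 2 <= \sum_(u : G) (deg u).-1.
Proof.
move=> G_gt1; have := connected_sum_deg.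
(* All degrees are positive, so the truncated predecessor loses nothing. *)
have -> : \sum_(u : G) deg u = \sum_(u : G) (1 + (deg u).-1).
  by apply: eq_bigr => u _; have := deg_gt0 u G_gt1; lia.
rewrite big_split /= (sum1_card G) -addnn.
by move: #|G| G_gt1 => N; lia.
Qed.

End Connected.

(** * The two product inequalities and their equality cases *)

Lemma prod_add1_ge_sum (I : finType) (P : pred I) (x : I -> nat) :
  1 + \sum_(i | P i) x i <= \prod_(i | P i) (1 + x i).
Proof.
by elim/big_ind2: _ => // a b c d; nia.
Qed.

(** Split off a positive [x i] and let [S] be the sum of the others. The product is at least
    [(1 + x i) * (1 + S)], whose cross term [x i * S] must vanish, so [S = 0]. If every [x i] is
    zero, any index such as [i0] will do. *)
Lemma prod_add1_eq_sum (I : finType) (x : I -> nat) (i0 : I) :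
  \prod_i (1 + x i) = 1 + \sum_i x i ->
  exists i, forall j, j != i -> x j = 0.
Proof.
have [/existsP[i xi]|/existsPn x0 _] := boolP [exists i, 0 < x i]; last first.
  by exists i0 => j _; have := x0 j; lia.
rewrite (bigD1 i) //= [in RHS](bigD1 i) //= => eq_prod; exists i => j ji.
have := prod_add1_ge_sum _ (fun j => j != i) x.
have : x j <= \sum_(j | j != i) x j by rewrite (bigD1 j) //= leq_addr.
by nia.
Qed.

Lemma expnn_gt (d : nat) : 2 < d -> 4 ^ d.-1 < d ^ d.
Proof.
elim: d => // d IHd; rewrite ltnS leq_eqVlt => /predU1P[<- //|d_gt2].
have := IHd d_gt2; rewrite [d.+1.-1]/= [d.+1 ^ d.+1]expnS.
have -> : 4 ^ d = 4 * 4 ^ d.-1 by rewrite -expnS; congr (_ ^ _); lia.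
(* The extra factor [d.+1] is at least 4, since [2 < d]. *)
have : d ^ d <= d.+1 ^ d by rewrite leq_exp2r; lia.
by nia.
Qed.

Lemma expnn_ge (d : nat) : 4 ^ d.-1 <= d ^ d.
Proof. by case: d => [|[|[|d]]] //; apply/ltnW/expnn_gt. Qed.

Lemma prod_expnn_ge (I : finType) (P : pred I) (d : I -> nat) :
  4 ^ (\sum_(i | P i) (d i).-1) <= \prod_(i | P i) d i ^ d i.
Proof. by rewrite expn_sum; apply: leq_prod => i _; apply: expnn_ge. Qed.

(** One strict factor makes the whole product strict, because the bound on the remaining factors is
    positive. *)
Lemma prod_expnn_eq (I : finType) (d : I -> nat) :
  \prod_i d i ^ d i = 4 ^ (\sum_i (d i).-1) -> forall i, d i <= 2.
Proof.
move=> eq_prod i; rewrite leqNgt; apply/negP => /expnn_gt lt_i.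
move: eq_prod; rewrite (bigD1 i) //= [in RHS](bigD1 i) //= expnD.
have := prod_expnn_ge _ (fun j => j != i) d.
have : 0 < 4 ^ (\sum_(j | j != i) (d j).-1) by rewrite expn_gt0.
by nia.
Qed.

(** * Isomorphism invariance, and the values on stars and paths *)

Lemma zagreb1E (G : sgraph) : zagreb1 G = (\prod_(u : G) deg u) ^ 2.
Proof. by rewrite /zagreb1 expnS expn1 -big_split. Qed.

Lemma deg_giso (G H : sgraph) (f : G -> H) : bijective f ->
  (forall x y, sedge (f x) (f y) = sedge x y) -> forall x, deg (f x) = deg x.
Proof.
move=> f_bij fE x; rewrite /deg -(card_imset _ (bij_inj f_bij)).
have [g fK gK] := f_bij.
apply: eq_card => y; rewrite inE; apply/idP/imsetP => [xy|[z]].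
  by exists (g y); rewrite ?gK // inE -fE gK.
by rewrite inE -fE => xz ->.
Qed.

Lemma zagreb1_giso (G H : sgraph) : giso G H -> zagreb1 G = zagreb1 H.
Proof.
case=> f [f_bij fE]; rewrite /zagreb1 (reindex f) /=; last exact: onW_bij.
by apply: eq_bigr => x _; rewrite (deg_giso _ _ _ f_bij fE).
Qed.

Lemma zagreb2_giso (G H : sgraph) : giso G H -> zagreb2 G = zagreb2 H.
Proof.
case=> f [f_bij fE]; rewrite !zagreb2E (reindex f) /=; last exact: onW_bij.
by apply: eq_bigr => x _; rewrite (deg_giso _ _ _ f_bij fE).
Qed.

(** By counting, [s] enumerates all vertices, so indexing into [s] is a bijection; its inverse is
    the isomorphism. *)
Lemma giso_nth (G : sgraph) (n : nat) (e : rel 'I_n)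
    (es : symmetric e) (ei : irreflexive e) (x : G) (s : seq G) :
  uniq s -> size s = n -> #|G| = n ->
  (forall i j : 'I_n, sedge (nth x s i) (nth x s j) = e i j) ->
  giso G (SGraph es ei).
Proof.
move=> s_uniq s_size cG sE.
have f_inj : injective (fun i : 'I_n => nth x s i).
  by move=> i j /eqP; rewrite nth_uniq ?s_size // => /eqP/val_inj.
have [|g fK gK] := inj_card_bij f_inj; first by rewrite cG card_ord.
exists g; split; first by exists (fun i : 'I_n => nth x s i).
by move=> y z /=; rewrite -sE !gK.
Qed.

Lemma zagreb1_star (m : nat) : zagreb1 (star_graph m.+2) = m.+1 ^ 2.
Proof.
rewrite zagreb1E (bigD1 ord0) //= big1 ?muln1 => [|i i0].
  congr (_ ^ 2); rewrite /deg.
  have -> : [set v | sedge (ord0 : star_graph m.+2) v] = [set~ ord0].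
    by apply/setP => j; rewrite !inE /= /star_rel eq_sym andbT.
  by rewrite cardsC1 card_ord.
rewrite /deg; have -> : [set v | sedge (i : star_graph m.+2) v] = [set ord0].
  apply/setP => j; rewrite !inE /= /star_rel -!(inj_eq val_inj) /=.
  by move: i0; rewrite -(inj_eq val_inj) /=; lia.
exact: cards1.
Qed.

Lemma deg_path (n : nat) (i : 'I_n) :
  deg (i : path_graph n) = (0 < i) + (i.+1 < n).
Proof.
rewrite /deg -[[set v | _]]/[set j : 'I_n | path_rel i j].
have ltin := ltn_ord i; have lt_p : i.-1 < n by lia.
have [i0|i_gt0] := posnP i; case: ltnP => [lt_n|ge_n].
- rewrite (_ : [set j | _] = [set Ordinal lt_n]) ?cards1 //.
  by apply/setP => j; rewrite !inE /path_rel -(inj_eq val_inj) /=; lia.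
- apply/eqP; rewrite cards_eq0; apply/eqP/setP => j.
  by rewrite !inE /path_rel; have := ltn_ord j; lia.
- rewrite (_ : [set j | _] = [set Ordinal lt_p; Ordinal lt_n]).
    by rewrite cards2 -(inj_eq val_inj) /=; case: eqP => //=; lia.
  by apply/setP => j; rewrite !inE /path_rel -!(inj_eq val_inj) /=; lia.
- rewrite (_ : [set j | _] = [set Ordinal lt_p]) ?cards1 //.
  apply/setP => j; rewrite !inE /path_rel -(inj_eq val_inj) /=.
  by have := ltn_ord j; lia.
Qed.

Lemma zagreb2_path (m : nat) : zagreb2 (path_graph m.+2) = 4 ^ m.
Proof.
(* The two ends split off contribute [1 ^ 1]; each of the [m] inner vertices contributes [2 ^ 2]. *)
rewrite zagreb2E big_ord_recl big_ord_recr /= !deg_path /= ltnn mul1n muln1.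
rewrite -[in RHS](card_ord m) -prod_nat_const; apply: eq_bigr => i _.
by rewrite deg_path /= /bump /= !add1n !ltnS ltn_ord.
Qed.

(** * Recognising paths and stars from their degrees *)

Lemma deg1_neighbor_eq (G : sgraph) (x a b : G) :
  deg x <= 1 -> sedge x a -> sedge x b -> a = b.
Proof.
move=> /card_le1P dx xa xb.
by have := dx a; rewrite inE => /(_ xa b); rewrite !inE xb => /esym/eqP.
Qed.

Lemma deg2_neighbor_eq (G : sgraph) (x a b c : G) : deg x <= 2 -> a != b ->
  sedge x a -> sedge x b -> sedge x c -> c = a \/ c = b.
Proof.
move=> dx ab xa xb xc.
have : [set a; b] == [set v | sedge x v].
  rewrite eqEcard cards2 ab dx andbT.
  by apply/subsetP => y /set2P[]->; rewrite inE.
by move/eqP/setP/(_ c); rewrite !inE xc => /orP[]/eqP; [left|right].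
Qed.

Section Unroll.
Variables (G : sgraph) (x : G).
Hypotheses (Gconn : connected G) (dx : deg x = 1).
Hypothesis deg_le2 : forall u : G, deg u <= 2.

Definition unrolled (k : nat) (s : seq G) : Prop :=
  [/\ size s = k.+1, uniq s, nth x s 0 = x &
      forall i, i < k -> sedge (nth x s i) (nth x s i.+1)].

(** The walk already uses up the single neighbour of the leaf [x] and both neighbours of each inner
    vertex. For [i = 0] the left alternative always holds. *)
Lemma unrolled_neighbor {k s i y} : unrolled k s -> i < k ->
  sedge (nth x s i) y -> y = nth x s i.+1 \/ y = nth x s i.-1.
Proof.
case=> s_size s_uniq s0 sE ltik iy.
case: i ltik iy => [|i] ltik iy.
  left; apply: (deg1_neighbor_eq _ x); rewrite ?dx //; rewrite -{1}s0 //.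
  exact: sE.
apply: (deg2_neighbor_eq _ (nth x s i.+1)) iy => //.
- by rewrite nth_uniq ?s_size //; lia.
- exact: sE.
- by rewrite sedge_sym; apply: sE; lia.
Qed.

(** While some vertex is missed, an edge leaves the walk; it can only start at the last vertex, so
    it extends the walk. *)
Lemma unrolled_exists k : k < #|G| -> exists s, unrolled k s.
Proof.
elim: k => [_|k IHk ltkG].
  by exists [:: x]; split.
have [s us] := IHk (ltnW ltkG); have [s_size s_uniq s0 sE] := us.
have [y] : exists y, y \notin [set z in s].
  have /card_gt0P[y] : 0 < #|~: [set z in s]|.
    have := cardsC [set z in s]; rewrite cardsE (card_uniqP s_uniq) s_size; lia.
  by rewrite inE => yA; exists y.
have xs : x \in [set z in s] by rewrite inE -s0 mem_nth ?s_size.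
move=> /(connected_boundary _ Gconn xs)[a [b []]]; rewrite !inE => as_ bs ab.
have ltik1 : index a s < k.+1 by rewrite -s_size index_mem.
have aE : nth x s (index a s) = a by rewrite nth_index.
(* Earlier vertices of the walk have no neighbour off it. *)
have ik : index a s = k.
  apply/eqP; rewrite eqn_leq -ltnS ltik1 leqNgt /=; apply/negP => ltik.
  case: (@unrolled_neighbor _ _ _ b us ltik); rewrite ?aE // => bE;
    by case/negP: bs; rewrite bE mem_nth // s_size; lia.
exists (rcons s b); split; rewrite ?size_rcons ?s_size ?rcons_uniq ?bs //.
  by rewrite nth_rcons s_size.
move=> i; rewrite ltnS leq_eqVlt => /predU1P[->|ltik].
  by rewrite !nth_rcons s_size ltnS leqnn ltnn eqxx -ik aE.
by rewrite !nth_rcons s_size !ltnS ltik (ltnW ltik) sE.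
Qed.

Lemma giso_path (m : nat) : #|G| = m.+1 -> giso G (path_graph m.+1).
Proof.
move=> cG; have [|s us] := unrolled_exists m; first by rewrite cG.
have [s_size s_uniq s0 sE] := us.
apply: (@giso_nth _ _ _ _ _ x s) => // i j.
wlog ltij : i j / i < j.
  move=> IH; case: (ltngtP i j) => [/IH//|/IH|/val_inj->].
    by rewrite sedge_sym path_sym.
  by rewrite sedge_irrefl path_irrefl.
have ltjm := ltn_ord j; have ltim : i < m by lia.
rewrite /path_rel; apply/idP/idP => [ij|/orP[/eqP<-|/eqP ji]]; last 2 first.
- exact: sE.
- by lia.
(* There are no chords: [j] is [i.+1] or [i.-1], and [i < j] rules out the latter. *)
case: (unrolled_neighbor us ltim ij) => /eqP; rewrite nth_uniq ?s_size //; lia.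
Qed.

End Unroll.

(** Counting makes [u] adjacent to every other vertex; these are leaves, so every edge meets [u].
    Listing [u] first sends it to the centre 0 of the star. *)
Lemma giso_star (G : sgraph) (m : nat) (u : G) : #|G| = m.+1 ->
  deg u = m -> (forall v, v != u -> deg v = 1) -> giso G (star_graph m.+1).
Proof.
move=> cG du dv.
have uv v : sedge u v = (v != u).
  have /eqP/setP/(_ v) : [set v | sedge u v] == [set~ u].
    rewrite eqEcard cardsC1 cG -[#|[set v | _]|]/(deg u) du leqnn andbT.
    by apply/subsetP => w; rewrite !inE; apply: contraTneq => ->; rewrite sedge_irrefl.
  by rewrite !inE.
have eE y z : sedge y z = (y != z) && ((y == u) || (z == u)).
  have [->|yu] /= := eqVneq y u; first by rewrite uv andbT eq_sym.
  have [->|zu] /= := eqVneq z u; first by rewrite sedge_sym uv yu.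
  rewrite andbF; apply/negP => yz; case/eqP: zu.
  by apply: (deg1_neighbor_eq _ y); rewrite ?dv // sedge_sym uv.
pose s := u :: enum [set~ u].
have s_uniq : uniq s by rewrite /= mem_enum !inE eqxx enum_uniq.
have s_size : size s = m.+1 by rewrite /= -cardE cardsC1 cG.
apply: (@giso_nth _ _ _ _ _ u s) => // i j.
have nth0 (h : 'I_m.+1) : (nth u s h == u) = (val h == 0).
  by rewrite -[in LHS](_ : nth u s 0 = u) // nth_uniq ?s_size.
by rewrite eE !nth0 nth_uniq ?s_size.
Qed.

Theorem theorem4p6 (n k : nat) (hk : 1 <= k <= n - 1)
    (G : sgraph) (hG : Vnk n k G) :
  (zagreb1 G >= (n - 1) ^ 2 /\ zagreb2 G >= 4 ^ (n - 2)) /\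
  ((zagreb1 G = (n - 1) ^ 2 <-> giso G (star_graph n)) /\
   (zagreb2 G = 4 ^ (n - 2) <-> giso G (path_graph n))).
Proof.
case/and4P: hG => Gconn /eqP cG _ _.
move: n hk cG => [|[|m]] hk cG; [by lia | by lia | clear hk].
rewrite !subSS !subn0 zagreb1E zagreb2E.
have d_gt0 (u : G) : 0 < deg u by apply: deg_gt0; rewrite ?cG.
have sum_ge : m <= \sum_(u : G) (deg u).-1.
  by have := connected_sum_deg_pred G Gconn; rewrite cG subSS subn1 => /(_ isT).
have prodE : \prod_(u : G) deg u = \prod_(u : G) (1 + (deg u).-1).
  by apply: eq_bigr => u _; have := d_gt0 u; lia.
have ge1 : 1 + \sum_(u : G) (deg u).-1 <= \prod_(u : G) (1 + (deg u).-1).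
  exact: prod_add1_ge_sum.
have ge2 : 4 ^ (\sum_(u : G) (deg u).-1) <= \prod_(u : G) deg u ^ deg u.
  exact: prod_expnn_ge.
split; [split | split; split].
- by rewrite leq_exp2r // prodE; lia.
- by apply: leq_trans ge2; rewrite leq_exp2l.
- move=> /eqP; rewrite eqn_exp2r // prodE => /eqP eq1.
  have /card_gt0P[u0 _] : 0 < #|G| by rewrite cG.
  have [|u du] := prod_add1_eq_sum _ (fun u : G => (deg u).-1) u0; first lia.
  have dv v : v != u -> deg v = 1 by move/du; have := d_gt0 v; lia.
  apply: (giso_star _ _ u) => //.
  (* The whole excess [m] sits at [u], which therefore has degree [m.+1]. *)
  have : \sum_(u : G) (deg u).-1 = m by lia.
  by rewrite (bigD1 u) //= big1 ?addn0 //; have := d_gt0 u; lia.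
- by move/zagreb1_giso; rewrite -zagreb1E zagreb1_star.
- move=> eq2.
  (* Equality squeezes the exponent between [m] and [m]. *)
  have sumE : \sum_(u : G) (deg u).-1 = m.
    by apply/eqP; rewrite eqn_leq sum_ge andbT -(leq_exp2l (m := 4)) // -eq2.
  have d_le2 : forall u : G, deg u <= 2.
    by apply: prod_expnn_eq; rewrite sumE.
  have [/existsP[x /eqP dx]|/existsPn d_neq1] := boolP [exists x : G, deg x == 1].
    exact: (giso_path _ x).
  (* Without a leaf all degrees are 2, and the sum would be [m.+2] instead of [m]. *)
  have : \sum_(u : G) (deg u).-1 = \sum_(u : G) 1.
    by apply: eq_bigr => u _; have := d_neq1 u; have := d_gt0 u; have := d_le2 u; lia.
  by rewrite sumE (sum1_card G) cG; lia.
- by move/zagreb2_giso; rewrite -zagreb2E zagreb2_path.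
Qed.
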